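(* Let $n\ge 2$ and $N\ge 2$ be integers. (i) If $2\le N\le n+1$, then $E_L(n,N)\ge -\tau_1(n,N)$, where $$\tau_1(n,N)=N\sqrt{2N(N-1)}.$$ (ii) If $n+1\le N\le 2n$, then $E_L(n,N)\ge -\tau_2(n,N)$, where $$\tau_2(n,N)=\frac{N\left(2N(N-n-1)+(N-2)\sqrt{2nN(n-1)(N-2)}\right)}{Nn+N-4n}.$$ (iii) If $2n\le N\le n(n+3)/2$, then $E_L(n,N)\ge -\tau_3(n,N)$, where $$\tau_3(n,N)=N\sqrt{\frac{2N\left(nA_1+2(N-n-1)^2B_1\right)}{n^2(n-1)^2+4n(N-n-1)(N-2n)}},$$ $$A_1=Nn^3+(2N-1)n^2-(N-1)(7N-2)n+(N-1)^2(2N+3),\qquad B_1=\sqrt{n(n-1)N(N-n-1)}.$$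
   Context: $S^{n-1}$ is the unit sphere in $\mathbb{R}^n$, and $x\cdot y$ is the standard inner product. For $t\in[-1,1]$ put $L(t)=-\sqrt{2(1-t)}$, so that $L(x\cdot y)=-\|x-y\|$ for $x,y\in S^{n-1}$. For a set $\mathcal{C}=\{z_1,\dots,z_N\}\subset S^{n-1}$ of $N$ distinct points, define $E_L(\mathcal{C})=\sum_{i,j=1}^N L(z_i\cdot z_j)=-\sum_{i,j=1}^N\|z_i-z_j\|$ (sum over all ordered pairs; diagonal terms vanish), and $E_L(n,N)=\inf_{\mathcal{C}}E_L(\mathcal{C})$, the infimum being over all $N$-point subsets $\mathcal{C}$ of $S^{n-1}$. Thus the claims are upper bounds on the largest sum of pairwise distances $\tau(n,N)=-E_L(n,N)$. *)

(* Defs.v *)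
From HB Require Import structures.
From mathcomp Require Import all_boot all_order all_algebra finmap.
From mathcomp Require Import boolp classical_sets reals.

Set Implicit Arguments.
Unset Strict Implicit.
Unset Printing Implicit Defensive.

Import Order.TTheory GRing.Theory Num.Theory.
Local Open Scope ring_scope.
Local Open Scope classical_set_scope.

(* MathComp-Analysis equips row vectors with the sup norm, hence the explicit
   Euclidean inner product and norm. *)
Definition dotp (R : realType) (n : nat) (x y : 'rV[R]_n) : R :=
  \sum_(i < n) x 0 i * y 0 i.

Definition enorm (R : realType) (n : nat) (x : 'rV[R]_n) : R :=
  Num.sqrt (dotp x x).

(* The unit sphere of R^n, i.e. S^(n-1). *)
Definition sphere (R : realType) (n : nat) : set 'rV[R]_n :=
  [set x | enorm x = 1].
Arguments sphere {R} n _.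

(* Only the values for -1 <= t <= 1 matter; Num.sqrt is 0 on negative reals. *)
Definition L (R : realType) (t : R) : R := - Num.sqrt (2 * (1 - t)).

Lemma L_dotp (R : realType) (n : nat) (x y : 'rV[R]_n) :
  sphere n x -> sphere n y -> L (dotp x y) = - enorm (x - y).
Proof.
have unit (z : 'rV[R]_n) : sphere n z -> dotp z z = 1.
  move=> z1; rewrite -[LHS]sqr_sqrtr; last first.
    by apply: sumr_ge0 => i _; rewrite -expr2 sqr_ge0.
  by have -> : Num.sqrt (dotp z z) = 1 by []; rewrite expr1n.
move=> /unit x1 /unit y1; rewrite /L /enorm; congr (- Num.sqrt _).
have -> : dotp (x - y) (x - y) = dotp x x + dotp y y - 2 * dotp x y.
  rewrite /dotp mulr_sumr -big_split -sumrB; apply: eq_bigr => i _ /=.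
  by rewrite !mxE -!expr2 sqrrB mulr_natl addrAC.
by rewrite x1 y1 mulrBr mulr1.
Qed.

(* Sum over ordered pairs, diagonal included. *)
Definition energy (R : realType) (n : nat) (C : {fset 'rV[R]_n}) : R :=
  \sum_(x <- C) \sum_(y <- C) L (dotp x y).

(* For 2 <= n, [inf] is a genuine infimum: the set is nonempty, and it is
   bounded below by -2 N^2. *)
Definition min_energy (R : realType) (n N : nat) : R :=
  inf [set energy C | C in
        [set C : {fset 'rV[R]_n} |
          #|` C|%fset = N /\ forall x, x \in C -> sphere n x]].

(* The parameters are reals so that every subtraction is a real one. *)
Definition tau1 (R : realType) (n N : R) : R :=
  N * Num.sqrt (2 * N * (N - 1)).

Definition tau2 (R : realType) (n N : R) : R :=
  N * (2 * N * (N - n - 1)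
       + (N - 2) * Num.sqrt (2 * n * N * (n - 1) * (N - 2)))
  / (N * n + N - 4 * n).

Definition A1 (R : realType) (n N : R) : R :=
  N * n ^+ 3 + (2 * N - 1) * n ^+ 2 - (N - 1) * (7 * N - 2) * n
  + (N - 1) ^+ 2 * (2 * N + 3).

Definition B1 (R : realType) (n N : R) : R :=
  Num.sqrt (n * (n - 1) * N * (N - n - 1)).

Definition tau3 (R : realType) (n N : R) : R :=
  N * Num.sqrt (2 * N * (n * A1 n N + 2 * (N - n - 1) ^+ 2 * B1 n N)
                / (n ^+ 2 * (n - 1) ^+ 2
                   + 4 * n * (N - n - 1) * (N - 2 * n))).

(* Main.v *)
(** Linear programming bound. If the polynomial f(t) = a t^3 + b t^2 + c t + d
    lies below L on [-1, 1] and a, b, c >= 0, then summing f(x.y) over pairs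
    bounds the energy from below by N^2 (d + b/n) - N f(1), because the sums of
    (x.y) and (x.y)^3 are nonnegative and that of (x.y)^2 is at least N^2/n.
    In terms of the distance u (t = 1 - u^2/2, L(t) = -u), the condition f <= L
    becomes the nonnegativity of the polynomial -u - f in u, whose only odd
    term is -u. The optimal f interpolates L at the nodes of a quadrature rule
    having a further node t = 1 of weight 1/N, and -u - f then factors
    explicitly; the interpolation distances are v in (i), 2 and v in (ii), and
    the roots of u^2 - sg u + p in (iii). *)
Require Import Defs.
From mathcomp Require Import all_boot all_order all_algebra finmap.
From mathcomp Require Import boolp classical_sets reals.
From mathcomp Require Import ring lra.

Import Order.TTheory GRing.Theory Num.Theory.
Local Open Scope ring_scope.

(** * Moment inequalities for inner products *)

(** The k-th tensor powers of two points have inner product (x.y)^k, so the double sum is the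
    squared norm of the sum of these tensors, whose coordinates are indexed by [f]. *)
Lemma sum_dotp_exp_ge0 (R : realType) (n k : nat) (s : seq 'rV[R]_n) :
  0 <= \sum_(x <- s) \sum_(y <- s) dotp x y ^+ k.
Proof.
have -> : \sum_(x <- s) \sum_(y <- s) dotp x y ^+ k =
    \sum_(f : {ffun 'I_k -> 'I_n}) (\sum_(x <- s) \prod_(j < k) x 0 (f j)) ^+ 2.
  under [RHS]eq_bigr do rewrite expr2 big_distrlr.
  rewrite [RHS]exchange_big; apply: eq_bigr => x _.
  rewrite [RHS]exchange_big; apply: eq_bigr => y _.
  rewrite -[in LHS](card_ord k) -prodr_const bigA_distr_bigA.
  by apply: eq_bigr => f _; rewrite /= -big_split.
by apply: sumr_ge0 => f _; exact: sqr_ge0.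
Qed.

Lemma sum_dotp_sqr_ge (R : realType) (n : nat) (s : seq 'rV[R]_n) :
  (0 < n)%N -> {in s, forall x, dotp x x = 1} ->
  (size s)%:R ^+ 2 / n%:R <= \sum_(x <- s) \sum_(y <- s) dotp x y ^+ 2.
Proof.
move=> n0 s1; have nn0 : n%:R != 0 :> R by rewrite pnatr_eq0 -lt0n.
pose S i j := \sum_(x <- s) x 0 i * x 0 j.
(* The sum is the squared Frobenius norm of the Gram-type matrix S, whose
   trace is the number of points. *)
have -> : \sum_(x <- s) \sum_(y <- s) dotp x y ^+ 2 = \sum_i \sum_j S i j ^+ 2.
  transitivity (\sum_i \sum_j \sum_(x <- s) \sum_(y <- s)
      (x 0 i * x 0 j) * (y 0 i * y 0 j)).
    under [RHS]eq_bigr do rewrite exchange_big.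
    rewrite [RHS]exchange_big; apply: eq_bigr => x _.
    under [RHS]eq_bigr do rewrite exchange_big.
    rewrite [RHS]exchange_big; apply: eq_bigr => y _.
    rewrite expr2 big_distrlr; apply: eq_bigr => i _; apply: eq_bigr => j _ /=.
    by rewrite mulrACA.
  by apply: eq_bigr => i _; apply: eq_bigr => j _; rewrite expr2 big_distrlr.
have trS : \sum_i S i i = (size s)%:R.
  rewrite exchange_big -sum1_size natr_sum big_seq [RHS]big_seq.
  by apply: eq_bigr => x /s1.
apply: (@le_trans _ _ (\sum_i S i i ^+ 2)); last first.
  apply: ler_sum => i _; rewrite (bigD1 i) //= lerDl.
  by apply: sumr_ge0 => j _; exact: sqr_ge0.
set N := (size s)%:R in trS *.
(* Deviations of the diagonal from its mean: expanding them is Cauchy-Schwarz for the trace. *)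
have : 0 <= \sum_i (S i i - N / n%:R) ^+ 2.
  by apply: sumr_ge0 => i _; exact: sqr_ge0.
under eq_bigr do rewrite sqrrB -mulrnAl.
rewrite big_split sumrB /= -mulr_suml sumrMnl trS sumr_const card_ord.
by rewrite -(subr_ge0 (_ / _)); congr (0 <= _); field.
Qed.

(** * Passage from a polynomial minorant to the energy *)

Lemma energy_ge (R : realType) (n : nat) (C : {fset 'rV[R]_n}) (a b c d : R) :
  (0 < n)%N -> (forall x, x \in C -> sphere n x) ->
  0 <= a -> 0 <= b -> 0 <= c ->
  (forall u t, 0 <= u <= 2 -> t = 1 - u ^+ 2 / 2 ->
     a * t ^+ 3 + b * t ^+ 2 + c * t + d <= - u) ->
  #|` C|%:R ^+ 2 * (d + b / n%:R) - #|` C|%:R * (a + b + c + d) <= energy C.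
Proof.
move=> n0 CS a0 b0 c0 fL; pose f t := a * t ^+ 3 + b * t ^+ 2 + c * t + d.
have dotp1 : {in C, forall x, dotp x x = 1}.
  move=> x /CS x1; rewrite -[LHS]sqr_sqrtr.
    by have -> : Num.sqrt (dotp x x) = 1 by []; rewrite expr1n.
  by apply: sumr_ge0 => i _; rewrite -expr2 sqr_ge0.
have dotp_bound x y : x \in C -> y \in C -> -1 <= dotp x y <= 1.
  move=> /dotp1 x1 /dotp1 y1.
  (* Only e = 1 and e = -1 are used, giving |x + y|^2 >= 0 and |x - y|^2 >= 0. *)
  have sq e : 0 <= \sum_i (x 0 i + e * y 0 i) ^+ 2.
    by apply: sumr_ge0 => i _; exact: sqr_ge0.
  have E e : \sum_i (x 0 i + e * y 0 i) ^+ 2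
      = dotp x x + 2 * e * dotp x y + e ^+ 2 * dotp y y.
    rewrite /dotp !mulr_sumr -!big_split; apply: eq_bigr => i _ /=; ring.
  by have := sq 1; have := sq (-1); rewrite !E x1 y1; lra.
(* On the diagonal [L] vanishes, and subtracting f(1) gives equality there; this is the source of
   the term - N f(1). *)
have pair_ge x y : x \in C -> y \in C ->
    f (dotp x y) - (if y == x then f 1 else 0) <= L (dotp x y).
  move=> xC yC; case: eqP => [->|_].
    by rewrite dotp1 // subrr /L subrr mulr0 sqrtr0 oppr0.
  have /andP[t1 t2] := dotp_bound _ _ xC yC.
  set t := dotp x y in t1 t2 *; rewrite subr0 /L.
  set u := Num.sqrt (2 * (1 - t)).
  have u0 : 0 <= u by exact: sqrtr_ge0.
  have uE : u ^+ 2 = 2 * (1 - t) by rewrite sqr_sqrtr //; lra.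
  have tE : t = 1 - u ^+ 2 / 2 by rewrite uE; lra.
  by apply: fL => //; nra.
have diag : \sum_(x <- C) \sum_(y <- C) (if y == x then f 1 else 0)
    = #|` C|%:R * f 1.
  rewrite mulr_natl -[#|` C|]count_predT -iter_addr_0 -big_const_seq big_seq [RHS]big_seq.
  apply: eq_bigr => x xC; rewrite -big_mkcond -big_filter.
  by rewrite (filter_pred1_uniq (fset_uniq C)) // big_seq1.
apply: (@le_trans _ _ (\sum_(x <- C) \sum_(y <- C)
    (f (dotp x y) - (if y == x then f 1 else 0)))); last first.
  rewrite big_seq [leRHS]big_seq; apply: ler_sum => x xC.
  rewrite big_seq [leRHS]big_seq; apply: ler_sum => y yC.
  exact: pair_ge.
under eq_bigr do rewrite sumrB.
rewrite sumrB diag /f !expr1n !mulr1 lerD2r.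
under eq_bigr do rewrite !big_split -!mulr_sumr.
rewrite !big_split -!mulr_sumr.
have := sum_dotp_exp_ge0 _ _ 3 C.
have : 0 <= \sum_(x <- C) \sum_(y <- C) dotp x y := sum_dotp_exp_ge0 _ _ 1 C.
have := sum_dotp_sqr_ge _ _ C n0 dotp1.
rewrite !big_const_seq !count_predT !iter_addr_0.
rewrite -mulrnA -[d *+ _]mulr_natl natrM -expr2 /=.
set N := #|` C|%:R; move: (\sum_(x <- C) _) => S2; move: (\sum_(x <- C) _) => S1.
move: (\sum_(x <- C) _) => S3 /(ler_wpM2l b0) h2 /(mulr_ge0 c0) h1 /(mulr_ge0 a0) h3.
have -> : N ^+ 2 * (d + b / n%:R) = b * (N ^+ 2 / n%:R) + N ^+ 2 * d by ring.
lra.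
Qed.

Lemma min_energy_ge (R : realType) (n N : nat) (m : R) :
  m <= 0 ->
  (forall C : {fset 'rV[R]_n}, #|` C| = N ->
     (forall x, x \in C -> sphere n x) -> m <= energy C) ->
  m <= min_energy R n N.
Proof.
move=> m0 mE; rewrite /min_energy; set A := (X in inf X).
(* inf set0 = 0, hence the hypothesis m <= 0 *)
have [->|/set0P A0] := eqVneq A set0; first by rewrite inf0.
by apply: lb_le_inf => // _ [C [CN CS] <-]; exact: mE.
Qed.

(** * The three interpolating polynomials *)

Lemma min_energy_ge_tau1 (R : realType) (n N : nat) :
  (0 < n)%N -> (2 <= N)%N -> - tau1 (n%:R : R) N%:R <= min_energy R n N.
Proof.
move=> n0 hN; rewrite /tau1; set m := N%:R : R; set S := Num.sqrt _.
have m2 : 2 <= m by rewrite (ler_nat R 2).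
have S0 : 0 < S by rewrite sqrtr_gt0; nra.
have S2 : S ^+ 2 = 2 * m * (m - 1) by rewrite sqr_sqrtr //; nra.
(* Since v^2 = 2m/(m - 1), v is the edge of a regular simplex with m vertices inscribed in a unit
   sphere; the affine f below is tangent to [L] at that distance. *)
pose v := S / (m - 1).
have v0 : 0 < v by rewrite divr_gt0 //; lra.
apply: min_energy_ge => [|C CN CS]; first by nra.
have fL u t : 0 <= u <= 2 -> t = 1 - u ^+ 2 / 2 ->
    0 * t ^+ 3 + 0 * t ^+ 2 + v^-1 * t + - (v^-1 + v / 2) <= - u.
  move=> _ ->; rewrite -subr_ge0.
  have -> : - u - (0 * (1 - u ^+ 2 / 2) ^+ 3 + 0 * (1 - u ^+ 2 / 2) ^+ 2
      + v^-1 * (1 - u ^+ 2 / 2) + - (v^-1 + v / 2))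
      = (u - v) ^+ 2 / (2 * v) by field; rewrite gt_eqF.
  by rewrite divr_ge0 ?sqr_ge0 //; lra.
have vi0 : 0 <= v^-1 by rewrite invr_ge0 ltW.
apply: le_trans (energy_ge _ _ C _ _ _ _ n0 CS (lexx 0) (lexx 0) vi0 fL).
(* The linear programming value is exactly the claimed bound, so an identity remains. *)
rewrite CN -/m le_eqVlt; apply/orP; left; apply/eqP.
have SE : S = v * (m - 1) by rewrite /v; field; lra.
have vi : v^-1 = v * (m - 1) / (2 * m).
  apply: (mulfI (lt0r_neq0 v0)); rewrite mulfV ?gt_eqF //.
  have -> : v * (v * (m - 1) / (2 * m)) = (v * (m - 1)) ^+ 2 / (2 * m * (m - 1)).
    by field; lra.
  by rewrite -SE S2 divff //; nra.
have k0 : 0 < n%:R :> R by rewrite ltr0n.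
by rewrite SE vi; field; lra.
Qed.

Lemma min_energy_ge_tau2 (R : realType) (n N : nat) :
  (2 <= n)%N -> (n + 1 <= N)%N -> - tau2 (n%:R : R) N%:R <= min_energy R n N.
Proof.
move=> hn hN; rewrite /tau2; set k := n%:R : R; set m := N%:R : R; set S := Num.sqrt _.
have k2 : 2 <= k by rewrite (ler_nat R 2).
have mk : k + 1 <= m by rewrite -(natrD R n 1) ler_nat.
have S0 : 0 < S by rewrite sqrtr_gt0 !mulr_gt0 //; lra.
have S2 : S ^+ 2 = 2 * k * m * (k - 1) * (m - 2).
  by rewrite sqr_sqrtr // !mulr_ge0 //; lra.
have D0 : 0 < m * k + m - 4 * k by nra.
have num0 : 0 <= 2 * m * (m - k - 1) + (m - 2) * S by rewrite addr_ge0 ?mulr_ge0 //; lra.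
(* The inner product at distance v is (m - 2k)/(k(m - 2)): it is -1/k for a simplex (m = k + 1) and
   0 for a cross-polytope (m = 2k). *)
pose v := S / (k * (m - 2)).
have km0 : 0 < k * (m - 2) by rewrite mulr_gt0 //; lra.
have v0 : 0 < v by rewrite divr_gt0.
apply: min_energy_ge => [|C CN CS].
  by rewrite oppr_le0 divr_ge0 ?mulr_ge0 //; lra.
(* [A] normalizes the coefficient of u in the factored form below to -1; the factor u + 2 + 2v there
   cancels the u^3 term. The root 2 may be simple, being an endpoint. *)
pose A := (2 * v * (v + 2) ^+ 2)^-1; pose K := 3 * v ^+ 2 + 4 * v + 4.
have v2 : 0 < v + 2 by rewrite addr_gt0.
have A0 : 0 < A by rewrite invr_gt0 mulr_gt0 ?exprn_gt0 // mulr_gt0.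
pose b := 4 * A; pose c := A * (2 * K - 8).
pose d := A * (4 - 2 * K - 4 * (1 + v) * v ^+ 2).
have fL u t : 0 <= u <= 2 -> t = 1 - u ^+ 2 / 2 ->
    0 * t ^+ 3 + b * t ^+ 2 + c * t + d <= - u.
  move=> /andP[u0 u2] tE; rewrite -subr_ge0.
  have -> : - u - (0 * t ^+ 3 + b * t ^+ 2 + c * t + d)
      = A * ((2 - u) * (u - v) ^+ 2 * (u + 2 + 2 * v)).
    by rewrite tE /b /c /d /K /A; field; apply/andP; split; rewrite gt_eqF //; lra.
  apply: mulr_ge0 (ltW A0) _; apply: mulr_ge0; last by lra.
  by apply: mulr_ge0; [lra | exact: sqr_ge0].
have b0 : 0 <= b by rewrite /b; lra.
have c0 : 0 <= c by rewrite mulr_ge0 ?ltW // /K; nra.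
have n0 : (0 < n)%N by exact: ltnW.
apply: le_trans (energy_ge _ _ C _ _ _ _ n0 CS (lexx 0) b0 c0 fL).
rewrite CN -/m -/k le_eqVlt; apply/orP; left; apply/eqP.
have ki : k^-1 = 1 - v ^+ 2 * (m - 2) / (2 * m).
  rewrite /v expr_div_n S2; field; lra.
(* Both sides reduce to this form in m and v, the right one through [ki]. *)
transitivity (- (m * (2 * m + 2 * v * (m - 1)) / (2 + v))).
  have v2' : 0 < 2 + v by rewrite addr_gt0.
  congr (- _); apply/eqP; rewrite eqr_div ?lt0r_neq0 //; apply/eqP.
  have -> : S = v * (k * (m - 2)) by rewrite /v; field; lra.
  have H : v ^+ 2 * (k * (m - 2)) = 2 * m * (k - 1).
    by rewrite /v expr_div_n S2; field; lra.
  transitivity (m * (4 * m * (m - k - 1) + 2 * m * v * (m - k - 1)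
      + (m - 2) * (2 * v * (k * (m - 2)) + v ^+ 2 * (k * (m - 2))))); first by ring.
  by rewrite H; ring.
by rewrite ki /b /c /d /K /A; field; lra.
Qed.

Lemma min_energy_ge_tau3 (R : realType) (n N : nat) :
  (2 <= n)%N -> (2 * n <= N)%N -> - tau3 (n%:R : R) N%:R <= min_energy R n N.
Proof.
move=> hn hN; rewrite /tau3; set k := n%:R : R; set m := N%:R : R.
have k2 : 2 <= k by rewrite (ler_nat R 2).
have mk : 2 * k <= m by rewrite -natrM ler_nat.
set B := B1 k m.
have B0 : 0 < B by rewrite sqrtr_gt0 !mulr_gt0 //; lra.
have B2 : B ^+ 2 = k * (k - 1) * m * (m - k - 1).
  by rewrite sqr_sqrtr // !mulr_ge0 //; lra.
set Q := Num.sqrt _.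
apply: min_energy_ge => [|C CN CS].
  by rewrite oppr_le0 mulr_ge0 ?sqrtr_ge0 //; lra.
(* For interpolation nodes t1, t2 at distances u1, u2: s = -(t1 + t2), p = u1 u2 and sg = u1 + u2,
   whence sg^2 = (u1^2 + u2^2) + 2p = 4 + 2s + 2p. *)
pose M := m - k - 1; pose s := (k - 1) / M.
have M0 : 0 < M by rewrite /M; lra.
have s0 : 0 < s by rewrite divr_gt0 //; lra.
pose p := 2 * B / (k * M).
have p0 : 0 < p by rewrite divr_gt0 ?mulr_gt0 //; lra.
have p2 : p ^+ 2 = 4 * (k - 1) * m / (k * M).
  rewrite /p expr_div_n exprMn B2 /M; field; lra.
pose sg := Num.sqrt (4 + 2 * s + 2 * p).
have sg0 : 0 < sg by rewrite sqrtr_gt0; lra.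
have sg2 : sg ^+ 2 = 4 + 2 * s + 2 * p by rewrite sqr_sqrtr //; lra.
(* Again [A] makes the coefficient of u equal to -1; the last factor of the factored form cancels
   u^3 and u^5. *)
pose A := (2 * sg ^+ 3 * p)^-1.
have A0 : 0 < A by rewrite invr_gt0 mulr_gt0 // mulr_gt0 ?exprn_gt0.
pose b' q := 4 * (2 * q - 3 * p - 6).
pose c' q := 24 + 24 * p - 16 * q + 2 * q ^+ 2 - 2 * q * p + 6 * p ^+ 2.
pose d' q := - (8 + 4 * (3 * p - 2 * q) + 2 * (q ^+ 2 - q * p + 3 * p ^+ 2)
  + p ^+ 2 * (q + p)).
pose a := 8 * A; pose b := A * b' (sg ^+ 2); pose c := A * c' (sg ^+ 2).
pose d := A * d' (sg ^+ 2).
have fL u t : 0 <= u <= 2 -> t = 1 - u ^+ 2 / 2 ->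
    a * t ^+ 3 + b * t ^+ 2 + c * t + d <= - u.
  move=> /andP[u0 u2] tE; rewrite -subr_ge0.
  have -> : - u - (a * t ^+ 3 + b * t ^+ 2 + c * t + d)
      = A * ((u ^+ 2 - sg * u + p) ^+ 2 * (u ^+ 2 + 2 * sg * u + sg ^+ 2 + p)).
    by rewrite tE /a /b /c /d /b' /c' /d' /A; field; apply/andP; split; rewrite gt_eqF.
  rewrite mulr_ge0 ?(ltW A0) // mulr_ge0 ?sqr_ge0 //; nra.
have a0 : 0 <= a by rewrite /a; lra.
have b0 : 0 <= b by rewrite mulr_ge0 ?ltW // sg2 /b'; lra.
(* After substituting [sg2], [c'] is 10p^2 + 16p + 12sp + 8s^2 - 8, so p must stay away from 0. *)
have p2ge : 2 <= p ^+ 2.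
  rewrite p2 ler_pdivlMr ?mulr_gt0 //; first by rewrite /M; nra.
  lra.
have c0 : 0 <= c by rewrite mulr_ge0 1?ltW // sg2 /c'; nra.
have n0 : (0 < n)%N by exact: ltnW.
apply: le_trans (energy_ge _ _ C _ _ _ _ n0 CS a0 b0 c0 fL).
rewrite CN -/m -/k le_eqVlt; apply/orP; left; apply/eqP.
(* The radicand in [tau3] is a perfect square in terms of p and sg. *)
transitivity (- (m * ((2 * m + p * (m - 1)) / sg))).
  congr (- (m * _)); rewrite /Q -/B -/M.
  set D := k ^+ 2 * _ + _.
  have D0 : 0 < D.
    apply: ltr_wpDr; first by rewrite !mulr_ge0 //; lra.
    by apply: mulr_gt0; rewrite exprn_gt0 //; lra.
  have BE : B = p * (k * M) / 2 by rewrite /p; field; lra.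
  have -> : 2 * m * (k * A1 k m + 2 * M ^+ 2 * B) / D = ((2 * m + p * (m - 1)) / sg) ^+ 2.
    rewrite expr_div_n sg2; apply/eqP; rewrite eqr_div ?lt0r_neq0 //; last by lra.
    apply/eqP; rewrite BE.
    transitivity (2 * m * k * (A1 k m * (4 + 2 * s) + 2 * M ^+ 3 * p ^+ 2
      + p * (2 * A1 k m + M ^+ 3 * (4 + 2 * s)))); first by field.
    transitivity ((4 * m ^+ 2 + (m - 1) ^+ 2 * p ^+ 2 + 4 * m * p * (m - 1)) * D);
      last by ring.
    by rewrite p2 /s /D /A1 /M; field; lra.
  rewrite sqrtr_sqr ger0_norm // divr_ge0 ?(ltW sg0) //; nra.
(* The bound divided by m A: only even powers of sg occur, so [sg2] eliminates sg. *)
have key : m * (d' (sg ^+ 2) + b' (sg ^+ 2) / k)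
    - (8 + b' (sg ^+ 2) + c' (sg ^+ 2) + d' (sg ^+ 2))
    = - (2 * sg ^+ 2 * p * (2 * m + p * (m - 1))).
  (* The relations defining p and s are solved for s and m, which turns the
     claim into a rational identity in k and p. *)
  have k1 : 0 < k + 1 by lra.
  have sE : s = (p ^+ 2 * k / 4 - k + 1) / (k + 1).
    by rewrite p2 /s /M; field; lra.
  have mE : m = p ^+ 2 * k / (4 * s).
    by rewrite p2 /s /M; field; lra.
  have e0 : p ^+ 2 * k / 4 - k + 1 != 0.
    apply: lt0r_neq0; rewrite -(pmulr_lgt0 _ (_ : 0 < (k + 1)^-1)) ?invr_gt0 //.
    by rewrite -sE.
  rewrite sg2 mE /b' /c' /d'.
  clear -sE e0 k2; clearbody p s k; subst s.
  by field; lra.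
rewrite /a /b /c /d; move: key; move: (b' _) (c' _) (d' _) => x y z key.
have -> : m ^+ 2 * (A * z + A * x / k) - m * (8 * A + A * x + A * y + A * z)
    = m * A * (m * (z + x / k) - (8 + x + y + z)) by ring.
by rewrite key /A; field; rewrite !gt_eqF.
Qed.

Theorem proposition5p1 (R : realType) (n N : nat)
    (hn : (2 <= n)%N) (hN : (2 <= N)%N) :
  [/\ (2 <= N <= n + 1)%N ->
        min_energy R n N >= - tau1 (n%:R : R) N%:R,
      (n + 1 <= N <= 2 * n)%N ->
        min_energy R n N >= - tau2 (n%:R : R) N%:R
    & (2 * n <= N <= n * (n + 3) %/ 2)%N ->
        min_energy R n N >= - tau3 (n%:R : R) N%:R].
Proof.
split=> /andP[N1 _]; first exact: min_energy_ge_tau1 (ltnW hn) hN.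
  exact: min_energy_ge_tau2.
exact: min_energy_ge_tau3.
Qed.
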